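(* Every nested sequence of closed intervals in ${}^*\mathbb{R}$ has a non-empty intersection. That is, if $\alpha_n,\beta_n\in{}^*\mathbb{R}$ with $\alpha_n<\beta_n$ and $[\alpha_{n+1},\beta_{n+1}]\subseteq[\alpha_n,\beta_n]$ for all $n\in\mathbb{N}$, then $\bigcap_{n\in\mathbb{N}}[\alpha_n,\beta_n]\neq\varnothing$.
   Context: $\mathbb{R}_+$ is the set of positive real numbers and $\mathbb{N}=\{1,2,3,\dots\}$. Fix an ultrafilter $\mathcal{U}$ on $\mathbb{R}_+$ such that $(0,\tfrac1n)\in\mathcal{U}$ for all $n\in\mathbb{N}$. A property of $\varepsilon\in\mathbb{R}_+$ holds almost everywhere (a.e.) if the set of $\varepsilon$ for which it holds belongs to $\mathcal{U}$. For nets $(a_\varepsilon),(b_\varepsilon)\in\mathbb{C}^{\mathbb{R}_+}$ write $(a_\varepsilon)\sim(b_\varepsilon)$ if $a_\varepsilon=b_\varepsilon$ a.e.; $\langle a_\varepsilon\rangle$ is the equivalence class, and ${}^*\mathbb{C}=\mathbb{C}^{\mathbb{R}_+}/\!\sim$. ${}^*\mathbb{R}=\{\langle a_\varepsilon\rangle : a_\varepsilon\in\mathbb{R}\text{ a.e.}\}$, ordered by $\langle a_\varepsilon\rangle<\langle b_\varepsilon\rangle$ iff $a_\varepsilon<b_\varepsilon$ a.e. Intervals in ${}^*\mathbb{R}$ are taken with endpoints $\alpha<\beta$ in ${}^*\mathbb{R}$, and $[\alpha,\beta]=\{x\in{}^*\mathbb{R}:\alpha\le x\le\beta\}$. *)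

(* Defs.v *)
From HB Require Import structures.
From mathcomp Require Import all_boot all_order all_algebra.
From mathcomp Require Import interval_inference complex.
From mathcomp Require Import all_classical all_reals.

Set Implicit Arguments.
Unset Strict Implicit.
Unset Printing Implicit Defensive.

Import Order.TTheory GRing.Theory Num.Theory.

Local Open Scope classical_set_scope.
Local Open Scope ring_scope.
Local Open Scope quotient_scope.

Section Nonstandard.
Context {R : realType} (U : set_system {posnum R}) {UU : UltraFilter U}.

Definition net := {posnum R} -> R[i].

(* [\forall e \near U, P e] unfolds to [U [set e | P e]], i.e. "P holds a.e." *)
Definition ae_eq (a b : net) : bool := `[< \forall e \near U, a e = b e >].

Lemma ae_eqP a b : reflect (\forall e \near U, a e = b e) (ae_eq a b).
Proof. exact: asboolP. Qed.

Lemma ae_eq_refl : reflexive ae_eq.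
Proof. by move=> a; apply/ae_eqP; apply: nearW. Qed.

Lemma ae_eq_sym : symmetric ae_eq.
Proof.
by move=> a b; apply/ae_eqP/ae_eqP; apply: filterS => e ->.
Qed.

Lemma ae_eq_trans : transitive ae_eq.
Proof.
move=> b a c /ae_eqP ab /ae_eqP bc; apply/ae_eqP.
by apply: filterS2 ab bc => e -> ->.
Qed.

Definition ae_equiv : equiv_rel net :=
  EquivRel ae_eq ae_eq_refl ae_eq_sym ae_eq_trans.

Definition starC : Type := {eq_quot ae_equiv}.
HB.instance Definition _ := Choice.copy starC {eq_quot ae_equiv}.
HB.instance Definition _ := Quotient.copy starC {eq_quot ae_equiv}.

Definition starC_class (a : net) : starC := \pi_starC a.

Lemma starC_classP a b :
  starC_class a = starC_class b <-> \forall e \near U, a e = b e.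
Proof.
split=> [ab|ab]; first by apply/ae_eqP/(eqmodP ae_equiv).
by apply/(eqmodP ae_equiv)/ae_eqP.
Qed.

Lemma starC_class_repr x : starC_class (repr x) = x.
Proof. exact: reprK. Qed.

Definition is_starR : set starC :=
  [set x | exists2 a : net, x = starC_class a
                          & \forall e \near U, a e \is Num.real].

Definition starR : Type := {x : starC | x \in is_starR}.
HB.instance Definition _ := SubChoice.on starR.

Lemma starR_repr_real (x : starR) :
  \forall e \near U, repr (val x) e \is Num.real.
Proof.
have /set_mem[a xa areal] := valP x.
have /starC_classP : starC_class (repr (val x)) = starC_class a.
  by rewrite starC_class_repr.
by move=> xa'; apply: filterS2 xa' areal => e ->.
Qed.

(* The order of [R[i]] relates only numbers with the same imaginary part, and
   extends the usual order of the reals. *)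
Definition starR_lt (x y : starR) : bool :=
  `[< \forall e \near U, repr (val x) e < repr (val y) e >].

(* [starR_lt] does not depend on the representatives. *)
Lemma starR_ltP (x y : starR) (a b : net) :
  val x = starC_class a -> val y = starC_class b ->
  starR_lt x y <-> \forall e \near U, a e < b e.
Proof.
rewrite -(starC_class_repr (val x)) -(starC_class_repr (val y)).
move=> /starC_classP xa /starC_classP yb; split.
  by move=> /asboolP xy; apply: filterS3 xa yb xy => e -> ->.
by move=> ab; apply/asboolP; apply: filterS3 xa yb ab => e -> ->.
Qed.

Lemma starR_lt_irr : irreflexive starR_lt.
Proof.
move=> x; apply/negP => /asboolP xx.
have : \forall e \near U, False by apply: filterS xx => e; rewrite ltxx.
by move=> /filter_ex[].
Qed.

Lemma starR_lt_trans : transitive starR_lt.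
Proof.
move=> y x z /asboolP xy /asboolP yz; apply/asboolP.
by apply: filterS2 xy yz => e; apply: lt_trans.
Qed.

Lemma starR_lt_total x y : x != y -> starR_lt x y || starR_lt y x.
Proof.
move=> xy; apply/orP.
have [xy'|xy'] := in_ultra_setVsetC
    [set e | repr (val x) e < repr (val y) e] UU.
  by left; apply/asboolP.
have [yx'|yx'] := in_ultra_setVsetC
    [set e | repr (val y) e < repr (val x) e] UU.
  by right; apply/asboolP.
case/eqP: xy; apply/val_inj.
rewrite -(starC_class_repr (val x)) -(starC_class_repr (val y)).
apply/starC_classP.
have rr : \forall e \near U, repr (val x) e \is Num.real /\
                             repr (val y) e \is Num.real.
  by apply: filterS2 (starR_repr_real x) (starR_repr_real y).
apply: filterS3 xy' yx' rr => e /= /negP nxy /negP nyx [xr yr].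
by case: (real_ltgtP xr yr) nxy nyx.
Qed.

HB.instance Definition _ := @Order.LtOrder.Build ring_display starR
  _ starR_lt _ _ (fun _ _ => erefl) (fun _ _ => erefl) (fun _ _ => erefl)
  starR_lt_irr starR_lt_trans starR_lt_total.

Lemma starR_ltE (x y : starR) : (x < y) = starR_lt x y.
Proof. by []. Qed.

Lemma starR_leE (x y : starR) : (x <= y) = (x == y) || starR_lt x y.
Proof. by []. Qed.

End Nonstandard.

Arguments starC {R} U {UU}.
Arguments starC_class {R} U {UU}.
Arguments is_starR {R} U {UU}.
Arguments starR {R} U {UU}.

(* Main.v *)
(** Countable saturation: if every finite part of a countable family of
    conditions on [z] is solvable at almost every [e], then at each [e] solve the
    largest solvable part of index at most [1/e].  As [e < 1/n] a.e. for every
    [n], the resulting net meets every single condition a.e.  The conditions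
    "[z] lies between the representatives of [alpha n] and [beta n]" are of this
    kind, the first [n] of them being solved by [alpha n] itself. *)

Require Import Defs.
From HB Require Import structures.
From mathcomp Require Import all_boot all_order all_algebra.
From mathcomp Require Import interval_inference complex all_classical all_reals.

Set Implicit Arguments.
Unset Strict Implicit.
Unset Printing Implicit Defensive.

Import Order.TTheory GRing.Theory Num.Theory.

Local Open Scope classical_set_scope.
Local Open Scope ring_scope.

Lemma countable_saturation (R : realType) (U : set_system {posnum R})
    (T : Type) (t0 : T) (P : nat -> {posnum R} -> T -> Prop) :
  Filter U ->
  (forall n, (0 < n)%N -> U [set e : {posnum R} | e%:num < n%:R^-1]) ->
  (forall n, \forall e \near U, exists z, forall i, (i <= n)%N -> P i e z) ->
  exists x : {posnum R} -> T, forall n, \forall e \near U, P n e (x e).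
Proof.
move=> UF U0 solvable.
(* The bound on [e] leaves finitely many good [n] for each [e]; [n.+1] keeps the reciprocal
   meaningful at [n = 0]. *)
pose good n (e : {posnum R}) := e%:num < n.+1%:R^-1 /\
  exists z, forall i, (i <= n)%N -> P i e z.
have solve e : exists z, forall n, good n e -> P n e z.
  have [ex|nex] := pselect (exists n, `[< good n e >]); last first.
    by exists t0 => n gn; case: nex; exists n; apply/asboolP.
  have bounded n : `[< good n e >] -> (n <= Num.truncn (e%:num^-1))%N.
    move=> /asboolP[en _]; rewrite -ltnS -(ltr_nat R).
    apply: lt_trans (truncnS_gt _).
    apply: (@lt_trans _ _ n.+1%:R); first by rewrite ltr_nat.
    by rewrite -ltf_pV2 ?posrE ?invr_gt0 ?ltr0n // invrK.
  (* A solution for the largest good index [m] meets all conditions up to [m], hence that of every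
     good [n]. *)
  have [m /asboolP[_ [z zP]] mmax] := ex_maxnP ex bounded.
  by exists z => n gn; apply/zP/mmax/asboolP.
have [x xP] := choice solve.
exists x => n.
by apply: filterS2 (U0 n.+1 isT) (solvable n) => e en sn; apply: xP.
Qed.

(** The converse rests on totality: if it failed, [b e < a e] would hold a.e., and a proper filter
    excludes this. *)
Lemma starR_leP (R : realType) (U : set_system {posnum R})
    (UU : UltraFilter U) (x y : starR U) (a b : net) :
  val x = starC_class U a -> val y = starC_class U b ->
  x <= y <-> \forall e \near U, a e <= b e.
Proof.
move=> xa yb; split=> [|ab].
  rewrite le_eqVlt => /orP[/eqP xy|/(starR_ltP xa yb)].
    move: xa; rewrite xy yb => /starC_classP.
    by apply: filterS => e ->.
  by apply: filterS => e /ltW.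
rewrite leNgt; apply/negP => /(starR_ltP yb xa) ba.
have : \forall e \near U, False.
  by apply: filterS2 ab ba => e abe /(le_lt_trans abe); rewrite ltxx.
by move=> /filter_ex[].
Qed.

Theorem corollary2p10p6 (R : realType) (U : set_system {posnum R})
    (UU : UltraFilter U)
    (U0 : forall n : nat, (0 < n)%N -> U [set e : {posnum R} | e%:num < n%:R^-1])
    (alpha beta : nat -> starR U)
    (lt_alpha_beta : forall n : nat, (0 < n)%N -> alpha n < beta n)
    (nested : forall n : nat, (0 < n)%N ->
      `[alpha n.+1, beta n.+1]%classic `<=` `[alpha n, beta n]%classic) :
  \bigcap_(n in [set n : nat | (0 < n)%N]) `[alpha n, beta n]%classic !=set0.
Proof.
(* The hypotheses concern positive indices, so the sequences are shifted to start at 0. *)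
pose a n := repr (val (alpha n.+1)); pose b n := repr (val (beta n.+1)).
have aE n : val (alpha n.+1) = starC_class U (a n) by rewrite starC_class_repr.
have bE n : val (beta n.+1) = starC_class U (b n) by rewrite starC_class_repr.
have alpha_in n i : (i <= n)%N -> alpha n.+1 \in `[alpha i.+1, beta i.+1].
  move=> le_in.
  suff : `[alpha n.+1, beta n.+1]%classic `<=` `[alpha i.+1, beta i.+1]%classic.
    by apply; rewrite /= in_itv /= lexx ltW // lt_alpha_beta.
  elim: n le_in => [|n IH]; first by rewrite leqn0 => /eqP ->.
  rewrite leq_eqVlt => /orP[/eqP -> //|le_in].
  exact: subset_trans (nested n.+1 isT) (IH le_in).
have [|x xP] := countable_saturation
  (P := fun n e z => a n e <= z <= b n e) (0 : R[i]) _ U0.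
  move=> n.
  (* With [n] fixed, induction on [k] intersects finitely many a.e. sets; the strict [i < k] makes
     the base case vacuous. *)
  have below : forall k, (k <= n.+1)%N ->
      \forall e \near U, forall i, (i < k)%N -> a i e <= a n e <= b i e.
    elim=> [_|k IH le_kn]; first exact: nearW.
    have /andP[/(starR_leP (aE _) (aE _)) ak /(starR_leP (aE _) (bE _)) kb] :=
      alpha_in n k le_kn.
    apply: filterS3 ak kb (IH (ltnW le_kn)) => e ake kbe IHe i.
    by rewrite ltnS leq_eqVlt => /orP[/eqP ->|/IHe //]; rewrite ake kbe.
  by apply: filterS (below n.+1 (leqnn _)) => e ane; exists (a n e).
(* Comparable elements of [R[i]] share their imaginary part, so [x e], lying above the a.e. real
   [a 0 e], is a.e. real. *)
have xreal : starC_class U x \in is_starR U.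
  apply/mem_set; exists x => //.
  apply: filterS2 (xP 0%N) (starR_repr_real (alpha 1)) => e /andP[ax _].
  by rewrite (ger_real ax).
exists (Sub (starC_class U x) xreal) => -[//|n] _.
have xE : val (Sub (starC_class U x) xreal : starR U) = starC_class U x.
  exact: SubK.
rewrite /= in_itv /=; apply/andP; split.
  by apply/(starR_leP (aE n) xE); apply: filterS (xP n) => e /andP[].
by apply/(starR_leP xE (bE n)); apply: filterS (xP n) => e /andP[].
Qed.
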